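(* Let $K:=[-1,1]\times[0,1]\subset\mathbb{R}^2$ and for $(x,y)\in K$ define \[ f(x,y):=2\max\{1-y,|x|\}. \] Then $f\in\breve C(K)$ and $E_2(f;K)=\frac12$. Let $\mathcal{E}:=\{R\in\mathcal{P}_{2,2}:\|f-R\|_K=E_2(f;K)\}$ be the set of best quadratic approximations to $f$ on $K$. Then: (i) $P(x,y):=\frac32+x^2-y^2$ satisfies $P\in\mathcal{E}$ and $P\notin\breve C(K)$; (ii) $Q(x,y):=\frac32+x^2+y^2-2y$ satisfies $Q\in\mathcal{E}$ and $Q\in\breve C(K)$.
   Context: For a compact convex set $K\subset\mathbb{R}^n$ with nonempty interior, $C(K)$ is the space of continuous real-valued functions on $K$ with norm $\|f\|_K=\max_{x\in K}|f(x)|$, and $\breve C(K)$ is the set of those $f\in C(K)$ that are convex on $K$, i.e. satisfy $f(x)+f(y)\ge 2f((x+y)/2)$ for all $x,y\in K$ (polynomials are identified with their restrictions to $K$). $\mathcal{P}_{m,n}$ is the space of real algebraic polynomials of total degree $\le m$ in $n$ variables, and $E_m(f;K)=\inf_{P\in\mathcal{P}_{m,n}}\|f-P\|_K$. *)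

(* Defs.v *)
From HB Require Import structures.
From mathcomp Require Import all_boot all_order all_algebra.
From mathcomp Require Import all_classical all_reals topology normedtype.
(* The notations of mpoly clash with those of MathComp-Analysis. *)
From mathcomp.multinomials Require Import -(notations) mpoly.

Set Implicit Arguments.
Unset Strict Implicit.
Unset Printing Implicit Defensive.

Import Order.TTheory GRing.Theory Num.Theory.
Import numFieldNormedType.Exports.

Local Open Scope classical_set_scope.
Local Open Scope ring_scope.

Section Approximation.
Variables (R : realType) (n : nat).
Implicit Types (K : set 'rV[R]_n) (f : 'rV[R]_n -> R).

(* An element of C(K) is represented by any function on R^n extending it; all
   the notions below only depend on the values of f on K. *)
Definition C_space K : set ('rV[R]_n -> R) :=
  [set f | {within K, continuous f}].

(* For f continuous on a nonempty compact K the supremum is a maximum. *)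
Definition supnorm K f : R := sup [set `|f x| | x in K].

Definition convex_on K f : Prop :=
  forall x y : 'rV[R]_n, K x -> K y ->
    f x + f y >= 2 * f (2^-1 *: (x + y)).

Definition convexC K : set ('rV[R]_n -> R) :=
  [set f | C_space K f /\ convex_on K f].

Definition polyfun (P : mpoly n R) : 'rV[R]_n -> R :=
  fun x => meval (fun i => x 0 i) P.

(* [msize P] is the total degree plus one (and 0 for P = 0). *)
Definition poly_space (m : nat) : set (mpoly n R) :=
  [set P | (msize P <= m.+1)%N].

Definition best_error (m : nat) f K : R :=
  inf [set supnorm K (f \- polyfun P) | P in poly_space m].

Definition best_approx (m : nat) f K : set (mpoly n R) :=
  [set P | poly_space m P /\ supnorm K (f \- polyfun P) = best_error m f K].

Definition Xvar (i : 'I_n) : mpoly n R := mpolyX R (mnm1 i).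

End Approximation.

Arguments Xvar {R n} i.

(* Main.v *)
Require Import Defs.
From mathcomp Require Import all_boot all_order all_algebra.
From mathcomp Require Import all_classical all_reals topology normedtype.
From mathcomp.multinomials Require Import -(notations) mpoly.
From mathcomp Require Import ring lra.
Import Order.TTheory GRing.Theory Num.Theory.
Import numFieldNormedType.Exports.
Local Open Scope classical_set_scope.
Local Open Scope ring_scope.

(** The saddle [P] and the paraboloid [Q] both stay within [1/2] of the roof function
    [f(x,y) = 2 max(1 - y, |x|)] on the rectangle, and no quadratic does better.

    Upper bound.  With [u = 1 - y], and for [|x| <= u],
      [f - P = u^2 - x^2 - 1/2]       lies in [[-1/2, 1/2]] since
                                      [0 <= |x| <= u <= 1], and
      [f - Q = 1/2 - (1 - u)^2 - x^2] does too, since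
                                      [(1 - u)^2 + x^2 <= (1 - u)^2 + u^2 <= 1].
    When [u <= |x|] the roles of [u] and [|x|] are exchanged in [f - Q], while
    [f - P = (1 - u)^2 - (1 - |x|)^2 - 1/2] is bounded as in the first case.

    Lower bound.  The deviations of both quadratics reach [+1/2] at
    [(0,0)], [(1,1)], [(-1,1)] and [-1/2] at [(0,1)], [(1,0)], [(-1,0)].
    Weighting these points by [2, 1, 1, -2, -1, -1] gives the functional
    [mixed_diff], the second difference in [x] of the first difference in [y].
    It is a difference of total order three, so it vanishes on polynomials of
    degree at most two ([mixed_diff_poly_eq0]); its weights have absolute sum
    [8] and its value at [f] is [4], hence no quadratic is closer to [f] than
    [4/8] ([roof_error_ge]).  A polynomial reaching a lower bound common to all
    competitors is a best approximation ([best_approx_of_bound]), which turns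
    the two estimates into the claim.

    Convexity of [f] and [Q] is elementary; [P] is strictly concave along the
    vertical segment [x = 0], so it is not convex. *)

(** * Uniform norm and best approximation *)

Lemma supnorm_ge (R : realType) (n : nat) (K : set 'rV[R]_n)
    (g : 'rV[R]_n -> R) (M : R) (x : 'rV[R]_n) :
  (forall z, K z -> `|g z| <= M) -> K x -> `|g x| <= supnorm K g.
Proof.
move=> gM Kx; apply: ub_le_sup; last by exists x.
by exists M => _ [z Kz <-]; exact: gM.
Qed.

Lemma supnorm_le (R : realType) (n : nat) (K : set 'rV[R]_n)
    (g : 'rV[R]_n -> R) (M : R) :
  K !=set0 -> (forall z, K z -> `|g z| <= M) -> supnorm K g <= M.
Proof.
move=> [x Kx] gM; apply: ge_sup; first by exists `|g x|, x.
by move=> _ [z Kz <-]; exact: gM.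
Qed.

(** Best approximations are certified by weak duality: a lower bound [e] valid
    for every competitor and reached by [P] is at once the best error and the
    proof that [P] is optimal. *)
Lemma best_approx_of_bound (R : realType) (n m : nat) (K : set 'rV[R]_n)
    (f : 'rV[R]_n -> R) (e : R) (P : mpoly n R) :
  K !=set0 ->
  (forall S, poly_space m S -> e <= supnorm K (f \- polyfun S)) ->
  poly_space m P -> (forall x, K x -> `|f x - polyfun P x| <= e) ->
  best_error m f K = e /\ best_approx m f K P.
Proof.
move=> K0 e_le mP Pe.
have normP : supnorm K (f \- polyfun P) = e.
  by apply/eqP; rewrite eq_le e_le // andbT; exact: supnorm_le.
have errE : best_error m f K = e.
  apply/eqP; rewrite eq_le; apply/andP; split.
    rewrite -normP; apply: ge_inf; last by exists P.
    by exists e => _ [S mS <-]; exact: e_le.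
  apply: lb_le_inf; first by exists e, P.
  by move=> _ [S mS <-]; exact: e_le.
by split=> //; split=> //; rewrite errE.
Qed.

(** Each monomial is at most [1] in absolute value on the cube, so the sum of
    the absolute values of the coefficients is a bound.  Boundedness is what
    makes [supnorm] dominate pointwise values. *)
Lemma polyfun_bounded (R : realType) (n : nat) (P : mpoly n R) :
  exists M : R, forall x : 'rV[R]_n,
    (forall i, `|x 0 i| <= 1) -> `|polyfun P x| <= M.
Proof.
exists (\sum_(m <- msupp P) `|mcoeff m P|) => x x1.
rewrite /polyfun mevalE; apply: (le_trans (ler_norm_sum _ _ _)).
apply: ler_sum => m _; rewrite normrM ler_piMr // normr_prod.
apply: prodr_ile1 => i _; rewrite normr_ge0 normrX /=.
exact: exprn_ile1.
Qed.

Lemma poly_spaceD (R : realType) (n m : nat) (S T : mpoly n R) :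
  poly_space m S -> poly_space m T -> poly_space m (S + T).
Proof.
rewrite /poly_space /= => mS mT; apply: leq_trans (mmeasureD_le _ _ _) _.
by rewrite geq_max mS.
Qed.

Lemma poly_spaceN (R : realType) (n m : nat) (S : mpoly n R) :
  poly_space m S -> poly_space m (- S).
Proof. by rewrite /poly_space /= mmeasureN. Qed.

Lemma poly_spaceZ (R : realType) (n m : nat) (c : R) (S : mpoly n R) :
  poly_space m S -> poly_space m (c *: S).
Proof. by rewrite /poly_space /=; apply: leq_trans (mmeasureZ_le _ _ _). Qed.

Lemma poly_spaceC (R : realType) (n m : nat) (c : R) :
  poly_space m (mpolyC n c).
Proof. by rewrite /poly_space /= mmeasureC; case: (c != 0). Qed.

Lemma poly_spaceXn (R : realType) (n m : nat) (i : 'I_n) (k : nat) :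
  (k <= m)%N -> poly_space m (Xvar i ^+ k : mpoly n R).
Proof.
by move=> km; rewrite /poly_space /= /Xvar mpolyXn msizeX mdegMn mdeg1 mul1n.
Qed.

(** * The mixed third difference *)

Definition pt {R : realType} (x y : R) : 'rV[R]_2 :=
  \row_j (if j == 0 then x else y).

Lemma pt0 {R : realType} (x y : R) : pt x y 0 0 = x.
Proof. by rewrite mxE. Qed.

Lemma pt1 {R : realType} (x y : R) : pt x y 0 1 = y.
Proof. by rewrite mxE. Qed.

Definition mixed_diff {R : realType} (g : 'rV[R]_2 -> R) : R :=
  2 * g (pt 0 0) + g (pt 1 1) + g (pt (-1) 1)
  - (2 * g (pt 0 1) + g (pt 1 0) + g (pt (-1) 0)).

(** On a monomial [x^i y^j] the functional factors as
    [(1 + (-1)^i - 2 * 0^i) (1 - 0^j)].  The first factor vanishes unless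
    [i >= 2] (it is the second difference) and the second unless [j >= 1], so a
    monomial of degree less than three is always killed. *)
Lemma mixed_diff_poly_eq0 {R : realType} (S : mpoly 2 R) :
  poly_space 2 S -> mixed_diff (polyfun S) = 0.
Proof.
move=> degS; rewrite /mixed_diff /polyfun !mevalE !mulr_sumr -!big_split /=.
rewrite -sumrB big_seq big1 // => m mS.
have := leq_trans (msize_mdeg_lt mS) degS.
rewrite mdegE !big_ord_recl !big_ord0 /= !mulr1.
have -> : lift ord0 ord0 = 1 :> 'I_2 by exact: val_inj.
rewrite !pt0 !pt1.
case: (m ord0) => [|[|[|i]]]; case: (m 1) => [|[|[|j]]] // _;
  rewrite ?expr0 ?expr1 ?expr1n ?expr0n /=; ring.
Qed.

(** * The roof function *)

Definition rect {R : realType} : set 'rV[R]_2 :=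
  [set p : 'rV[R]_2 | -1 <= p 0 0 <= 1 /\ 0 <= p 0 1 <= 1].

Definition roof {R : realType} (p : 'rV[R]_2) : R :=
  2 * Num.max (1 - p 0 1) `|p 0 0|.

Lemma rect_pt {R : realType} (x y : R) :
  -1 <= x <= 1 -> 0 <= y <= 1 -> rect (pt x y).
Proof. by rewrite /rect /= pt0 pt1. Qed.

Lemma rect_neq0 {R : realType} : @rect R !=set0.
Proof. by exists (pt 0 0); apply: rect_pt; lra. Qed.

Lemma roofE {R : realType} (x y : R) : roof (pt x y) = 2 * Num.max (1 - y) `|x|.
Proof. by rewrite /roof pt0 pt1. Qed.

(** Replacing [|x|] by a number [a] with [a^2 = x^2] turns every estimate of
    [roof] against an even quadratic into polynomial inequalities on the two
    triangles [a <= 1 - y] and [1 - y <= a]. *)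
Lemma roof_cases {R : realType} (p : 'rV[R]_2) : rect p ->
  exists a : R, [/\ 0 <= a <= 1, p 0 0 ^+ 2 = a ^+ 2 &
    (a <= 1 - p 0 1 /\ roof p = 2 * (1 - p 0 1)) \/
    (1 - p 0 1 <= a /\ roof p = 2 * a)].
Proof.
move=> [/andP[x1 x2] _]; exists `|p 0 0|; split.
- by rewrite normr_ge0 ler_norml x1 x2.
- by rewrite real_normK ?num_real.
rewrite /roof; case: (leP `|p 0 0| (1 - p 0 1)) => h; [left|right].
- by split.
- by split=> //; exact: ltW.
Qed.

Lemma roof_continuous {R : realType} : continuous (@roof R).
Proof.
move=> p.
have cx i : {for p, continuous (fun q : 'rV[R]_2 => q 0 i)}.
  exact: coord_continuous.
apply: (@continuousM _ _ (fun=> 2)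
  (fun q : 'rV[R]_2 => Num.max (1 - q 0 1) `|q 0 0|)).
  exact: cst_continuous.
apply: (@continuous_max R _ (fun q : 'rV[R]_2 => 1 - q 0 1)
                            (fun q : 'rV[R]_2 => `|q 0 0|)).
  apply: (@continuousB R R^o _ (fun=> 1) (fun q : 'rV[R]_2 => q 0 1)).
    exact: cst_continuous.
  exact: cx.
apply: (@continuous_comp _ _ _ (fun q : 'rV[R]_2 => q 0 0 : R^o) Num.norm).
  exact: cx.
exact: norm_continuous.
Qed.

Lemma roof_convexC {R : realType} : convexC rect (@roof R).
Proof.
split; first by apply: continuous_subspaceT; exact: roof_continuous.
move=> x y _ _; rewrite /roof !mxE.
have max1 (a b : R) : a <= Num.max a b by rewrite le_max lexx.
have max2 (a b : R) : b <= Num.max a b by rewrite le_max lexx orbT.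
suff : Num.max (1 - 2^-1 * (x 0 1 + y 0 1)) `|2^-1 * (x 0 0 + y 0 0)| <=
  (Num.max (1 - x 0 1) `|x 0 0| + Num.max (1 - y 0 1) `|y 0 0|) / 2 by lra.
have := max1 (1 - x 0 1) `|x 0 0|; have := max2 (1 - x 0 1) `|x 0 0|.
have := max1 (1 - y 0 1) `|y 0 0|; have := max2 (1 - y 0 1) `|y 0 0|.
move=> y2 y1 x2 x1; rewrite ge_max; apply/andP; split; first lra.
rewrite normrM ger0_norm ?invr_ge0 ?ler0n //.
have := ler_normD (x 0 0) (y 0 0); lra.
Qed.

Lemma mixed_diff_roof {R : realType} : mixed_diff (@roof R) = 4.
Proof.
rewrite /mixed_diff !roofE normrN normr1 normr0 subr0 subrr.
rewrite maxxx (max_l (ler01 : 0 <= 1 :> R)) (max_r (ler01 : 0 <= 1 :> R)) maxxx.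
ring.
Qed.

(** Duality: [mixed_diff] sees only the error
    [roof - polyfun S], whose six values are each at most the norm, with total
    weight [8]. *)
Lemma roof_error_ge {R : realType} (S : mpoly 2 R) :
  poly_space 2 S -> 1 / 2 <= supnorm rect (roof \- polyfun S).
Proof.
move=> degS; have [M SM] := polyfun_bounded _ _ S.
have norm_ge x y : -1 <= x <= 1 -> 0 <= y <= 1 ->
    `|roof (pt x y) - polyfun S (pt x y)| <= supnorm rect (roof \- polyfun S).
  move=> x1 y1; apply: (supnorm_ge _ _ _ (roof \- polyfun S) (2 + M));
    last exact: rect_pt.
  move=> z Kz /=; apply: (le_trans (ler_normB _ _)); apply: lerD.
    have [a [a1 _ zE]] := roof_cases z Kz.
    by case: zE Kz => -[h ->] [_ z1]; rewrite ler_norml; lra.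
  apply: SM => i; case: Kz => zx zy; rewrite ler_norml.
  have [->|->] : i = 0 \/ i = 1; last 2 first.
  - by [].
  - lra.
  by case: i => [[|[|//]] ?]; [left|right]; exact: val_inj.
have S0 := mixed_diff_poly_eq0 S degS.
have r4 := @mixed_diff_roof R.
rewrite /mixed_diff in S0 r4.
have b01 : 0 <= (0 : R) <= 1 by lra.
have b11 : 0 <= (1 : R) <= 1 by lra.
have c0 : -1 <= (0 : R) <= 1 by lra.
have c1 : -1 <= (1 : R) <= 1 by lra.
have cN : -1 <= (-1 : R) <= 1 by lra.
move: (norm_ge _ _ c0 b01) (norm_ge _ _ c1 b11) (norm_ge _ _ cN b11).
move: (norm_ge _ _ c0 b11) (norm_ge _ _ c1 b01) (norm_ge _ _ cN b01).
rewrite !ler_norml; lra.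
Qed.

(** * The two quadratics *)

Definition saddle {R : realType} : mpoly 2 R :=
  mpolyC 2 (3 / 2) + Xvar 0 ^+ 2 - Xvar 1 ^+ 2.

Definition paraboloid {R : realType} : mpoly 2 R :=
  mpolyC 2 (3 / 2) + Xvar 0 ^+ 2 + Xvar 1 ^+ 2 - 2 *: Xvar 1.

Lemma saddleE {R : realType} :
  polyfun (@saddle R) = fun p => 3 / 2 + p 0 0 ^+ 2 - p 0 1 ^+ 2.
Proof.
apply/funext => p; rewrite /polyfun /saddle /Xvar !expr2.
by rewrite mevalB mevalD !mevalM !mevalXU mevalC.
Qed.

Lemma paraboloidE {R : realType} :
  polyfun (@paraboloid R) =
  fun p => 3 / 2 + p 0 0 ^+ 2 + p 0 1 ^+ 2 - 2 * p 0 1.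
Proof.
apply/funext => p; rewrite /polyfun /paraboloid /Xvar !expr2.
by rewrite mevalB !mevalD !mevalM mevalZ !mevalXU mevalC.
Qed.

Lemma saddle_quadratic {R : realType} : poly_space 2 (@saddle R).
Proof.
apply: poly_spaceD; last by apply: poly_spaceN; exact: poly_spaceXn.
by apply: poly_spaceD; [exact: poly_spaceC | exact: poly_spaceXn].
Qed.

Lemma paraboloid_quadratic {R : realType} : poly_space 2 (@paraboloid R).
Proof.
apply: poly_spaceD; last first.
  by apply: poly_spaceN; apply: poly_spaceZ; exact: (poly_spaceXn _ _ _ _ 1).
apply: poly_spaceD; last exact: poly_spaceXn.
by apply: poly_spaceD; [exact: poly_spaceC | exact: poly_spaceXn].
Qed.

Lemma saddle_error_le {R : realType} (p : 'rV[R]_2) :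
  rect p -> `|roof p - polyfun saddle p| <= 1 / 2.
Proof.
move=> Kp; have [a [a1 xE pE]] := roof_cases p Kp.
rewrite saddleE /= xE ler_norml; case: Kp => _.
by case: pE => -[h ->] y1; nra.
Qed.

Lemma paraboloid_error_le {R : realType} (p : 'rV[R]_2) :
  rect p -> `|roof p - polyfun paraboloid p| <= 1 / 2.
Proof.
move=> Kp; have [a [a1 xE pE]] := roof_cases p Kp.
rewrite paraboloidE /= xE ler_norml; case: Kp => _.
by case: pE => -[h ->] y1; nra.
Qed.

(** Along [x = 0] the saddle is [3/2 - y^2]: its values at [y = 0] and [y = 1]
    add up to [2], less than [5/2], twice its value at [y = 1/2]. *)
Lemma saddle_not_convex {R : realType} : ~ convex_on rect (polyfun (@saddle R)).
Proof.
have K0 : rect (pt 0 0 : 'rV[R]_2) by apply: rect_pt; lra.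
have K1 : rect (pt 0 1 : 'rV[R]_2) by apply: rect_pt; lra.
by move=> /(_ _ _ K0 K1); rewrite saddleE /= !mxE /=; lra.
Qed.

Lemma paraboloid_continuous {R : realType} :
  continuous (polyfun (@paraboloid R)).
Proof.
rewrite paraboloidE => p.
have cx i : {for p, continuous (fun q : 'rV[R]_2 => q 0 i)}.
  exact: coord_continuous.
have cx2 i : {for p, continuous (fun q : 'rV[R]_2 => q 0 i ^+ 2)}.
  under [X in {for _, continuous X}]eq_fun do rewrite expr2.
  by apply: (@continuousM _ _ (fun q : 'rV[R]_2 => q 0 i)
                              (fun q : 'rV[R]_2 => q 0 i)); exact: cx.
apply: (@continuousB R R^o _
  (fun q : 'rV[R]_2 => 3 / 2 + q 0 0 ^+ 2 + q 0 1 ^+ 2)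
  (fun q : 'rV[R]_2 => 2 * q 0 1)).
  apply: (@continuousD R R^o _ (fun q : 'rV[R]_2 => 3 / 2 + q 0 0 ^+ 2)
                               (fun q : 'rV[R]_2 => q 0 1 ^+ 2)).
    apply: (@continuousD R R^o _ (fun=> 3 / 2)
                                 (fun q : 'rV[R]_2 => q 0 0 ^+ 2)).
      exact: cst_continuous.
    exact: cx2.
  exact: cx2.
apply: (@continuousM _ _ (fun=> 2) (fun q : 'rV[R]_2 => q 0 1)).
  exact: cst_continuous.
exact: cx.
Qed.

Lemma paraboloid_convexC {R : realType} :
  convexC rect (polyfun (@paraboloid R)).
Proof.
split; first by apply: continuous_subspaceT; exact: paraboloid_continuous.
move=> x y _ _; rewrite paraboloidE /= !mxE.
(* The defect of convexity is half the squared distance between the points. *)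
have := sqr_ge0 (x 0 0 - y 0 0); have := sqr_ge0 (x 0 1 - y 0 1); nra.
Qed.

Theorem proposition1p8 (R : realType) :
  let K : set 'rV[R]_2 :=
    [set p : 'rV[R]_2 | -1 <= p 0 0 <= 1 /\ 0 <= p 0 1 <= 1] in
  let f : 'rV[R]_2 -> R :=
    fun p => 2 * Num.max (1 - p 0 1) `|p 0 0| in
  let X : mpoly 2 R := Xvar 0 in
  let Y : mpoly 2 R := Xvar 1 in
  let P : mpoly 2 R := mpolyC 2 (3 / 2) + X ^+ 2 - Y ^+ 2 in
  let Q : mpoly 2 R :=
    mpolyC 2 (3 / 2) + X ^+ 2 + Y ^+ 2 - 2 *: Y in
  [/\ convexC K f,
      best_error 2 f K = 1 / 2,
      best_approx 2 f K P /\ ~ convexC K (polyfun P)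
    & best_approx 2 f K Q /\ convexC K (polyfun Q)].
Proof.
have K0 := @rect_neq0 R.
have [errE bestP] := best_approx_of_bound _ _ _ _ _ _ _ K0 roof_error_ge
  saddle_quadratic saddle_error_le.
have [_ bestQ] := best_approx_of_bound _ _ _ _ _ _ _ K0 roof_error_ge
  paraboloid_quadratic paraboloid_error_le.
move=> K f X Y P Q; split.
- exact: roof_convexC.
- exact: errE.
- by split; [exact: bestP | case=> _; exact: saddle_not_convex].
- by split; [exact: bestQ | exact: paraboloid_convexC].
Qed.
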